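(* Let $p$ be a prime, $n\ge1$ an integer, and let $G$ be the GGS-group over the $p^n$-adic tree with defining vector $\mathbf{e}=(e_1,\dots,e_{p^n-1})\in\mathcal{F}(p^n)$. Let $Y=\{1\le i\le p^n-1\mid e_i\not\equiv0\bmod p\}$. Suppose that $\mathbf{e}$ is constant on $Y$ (i.e. $e_i=e_j$ for all $i,j\in Y$) and constant equal to $0$ outside $Y$ (i.e. $e_i=0$ for all $i\notin Y$), without $\mathbf{e}$ being constant. Then $G$ is a regular branch group over $\gamma_3(G)$.
   Context: Let $m=p^n$ and $X=\{x_1,\dots,x_m\}$. The $p^n$-adic tree $\mathcal{T}$ is the rooted tree whose vertices are the words of the free monoid $X^*$ (root: the empty word), with $u$ and $ux$ joined by an edge for $u\in X^*$, $x\in X$; the $\ell$-th level is the set of words of length $\ell$. $\mathrm{Aut}\,\mathcal{T}$ is the group of automorphisms of $\mathcal{T}$; products are composed left to right. For $f\in\mathrm{Aut}\,\mathcal{T}$ and $u\in X^*$, the section $f_u$ is defined by $f(uz)=f(u)f_u(z)$ for all $z\in X^*$. $\mathrm{st}(1)$ is the pointwise stabilizer of the first level, and $\psi:\mathrm{st}(1)\to(\mathrm{Aut}\,\mathcal{T})^{m}$, $\psi(f)=(f_{x_1},\dots,f_{x_m})$, is an isomorphism. For $G\le\mathrm{Aut}\,\mathcal{T}$ put $\mathrm{st}_G(1)=\mathrm{st}(1)\cap G$. $\gamma_i$ denotes the terms of the lower central series. GGS-groups: given a non-zero $\mathbf{e}=(e_1,\dots,e_{p^n-1})\in(\mathbb{Z}/p^n\mathbb{Z})^{p^n-1}$,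 the GGS-group with defining vector $\mathbf{e}$ is $G=\langle a,b\rangle$, where $a$ is the rooted automorphism $a(x_iz)=x_{i+1}z$ (indices modulo $p^n$, $z\in X^*$) and $b\in\mathrm{st}(1)$ is defined recursively by $\psi(b)=(a^{e_1},\dots,a^{e_{p^n-1}},b)$. $\mathcal{F}(p^n)=(\mathbb{Z}/p^n\mathbb{Z})^{p^n-1}\setminus(p\mathbb{Z}/p^n\mathbb{Z})^{p^n-1}$. Branching: $G$ is regular branch over a subgroup $K$ if $G$ is transitive on every level, $g_u\in G$ for all $g\in G$, $u\in X^*$, $1\ne K\le\mathrm{st}_G(1)$, $K\times\overset{m}{\cdots}\times K\subseteq\psi(K)$, and $|G:K|$ is finite. *)

(* Defs.v *)
From HB Require Import structures.
From mathcomp Require Import all_boot all_order all_algebra.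
From mathcomp Require Import boolp classical_sets functions cardinality.

Set Implicit Arguments.
Unset Strict Implicit.
Unset Printing Implicit Defensive.

Local Open Scope classical_set_scope.

(** * Subgroups of a possibly infinite group *)

Section Subgroups.
Local Open Scope group_scope.
Variable gT : groupType.
Implicit Types G H K A : set gT.

Definition is_subgroup H : Prop := H 1 /\ forall x y, H x -> H y -> H (x * y^-1).

Definition gen A : set gT := smallest is_subgroup A.

Definition comm_subgroup H K : set gT :=
  gen [set z | exists x y, [/\ H x, K y & z = [~ x, y]]].

(* [lower_central i G] is gamma_i(G), with the usual numbering
   gamma_1(G) = G; the value at i = 0 is junk (equal to G). *)
Definition lower_central (i : nat) G : set gT :=
  iter i.-1 (fun H => comm_subgroup H G) G.

Definition finite_index G K : Prop :=
  finite_set [set C : set gT | exists2 x, G x & C = [set x * k | k in K]].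

End Subgroups.

(** * The m-adic tree and its automorphisms *)

(* The letter x_i of X (1 <= i <= m) is the ordinal of value i - 1. *)
Definition word (m : nat) := seq 'I_m.

Definition tree_edge (m : nat) (u v : word m) : Prop :=
  (exists x, v = rcons u x) \/ (exists x, u = rcons v x).

Definition is_tree_aut (m : nat) (f : word m -> word m) : Prop :=
  [/\ bijective f, f [::] = [::] &
      forall u v, tree_edge u v <-> tree_edge (f u) (f v)].

Record tree_aut (m : nat) := TreeAut {
  tree_fun :> word m -> word m;
  tree_autP : is_tree_aut tree_fun }.

HB.instance Definition _ m := gen_eqMixin (tree_aut m).
HB.instance Definition _ m := gen_choiceMixin (tree_aut m).

Section TreeAut.
Variable m : nat.
Implicit Types (f g h : tree_aut m) (u v w z : word m).

Lemma tree_aut_ext f g : f =1 g -> f = g.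
Proof.
case: f g => [f fP] [g gP] /= /funext fg.
by case: g / fg gP => gP; congr TreeAut; exact: Prop_irrelevance.
Qed.

Lemma tree_aut_bij f : bijective f. Proof. by case: (tree_autP f). Qed.
Lemma tree_aut_inj f : injective f. Proof. exact: bij_inj (tree_aut_bij f). Qed.
Lemma tree_aut_nil f : f [::] = [::]. Proof. by case: (tree_autP f). Qed.

Lemma tree_aut_rcons f u x : exists y, f (rcons u x) = rcons (f u) y.
Proof.
case: (tree_autP f) => _ f0 fE.
elim/last_ind: u x => [|u y IH] x.
  have /fE[//|[y]] : tree_edge [::] (rcons [::] x) by left; exists x.
  by rewrite f0; case: (f _).
have /fE[//|[t]] : tree_edge (rcons u y) (rcons (rcons u y) x) by left; exists x.
have [s ->] := IH y; case/rcons_inj => /tree_aut_inj/(congr1 size).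
by rewrite !size_rcons => /eqP; rewrite -addn2 -[X in X == _]addn0 eqn_add2l.
Qed.

Lemma is_tree_autI (F : word m -> word m) : bijective F -> F [::] = [::] ->
  (forall u x, exists y, F (rcons u x) = rcons (F u) y) -> is_tree_aut F.
Proof.
move=> Fbij F0 FS; split=> //.
have dir u v : (exists x, F v = rcons (F u) x) -> exists x, v = rcons u x.
  case=> x; elim/last_ind: v => [|v y _]; first by rewrite F0; case: (F u).
  have [t ->] := FS v y; case/rcons_inj => /(bij_inj Fbij) -> _.
  by exists y.
move=> u v; split; case.
- by case=> x ->; have [y] := FS u x; left; exists y.
- by case=> x ->; have [y] := FS v x; right; exists y.
- by move/dir; left.
- by move/dir; right.
Qed.

Lemma tree_aut_cat f u z :
  f (u ++ z) = f u ++ drop (size u) (f (u ++ z)) /\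
  size (f (u ++ z)) = (size u + size z)%N.
Proof.
have sz w : size (f w) = size w.
  elim/last_ind: w => [|w x IH]; first by rewrite tree_aut_nil.
  by have [y ->] := tree_aut_rcons f w x; rewrite !size_rcons IH.
split; last by rewrite sz size_cat.
have [s ->] : exists s, f (u ++ z) = f u ++ s.
  elim/last_ind: z => [|z x [s IH]]; first by exists [::]; rewrite !cats0.
  have [y] := tree_aut_rcons f (u ++ z) x.
  by rewrite -rcons_cat IH => ->; exists (rcons s y); rewrite rcons_cat.
by rewrite drop_size_cat ?sz.
Qed.

Lemma tree_one_proof : is_tree_aut (fun u : word m => u).
Proof. by split=> //; exists id. Qed.

(* Products are composed from left to right. *)
Lemma tree_mul_proof f g : is_tree_aut (fun u => g (f u)).
Proof.
case: (tree_autP f) (tree_autP g) => [fb f0 fE] [gb g0 gE]; split.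
- exact: bij_comp gb fb.
- by rewrite f0 g0.
- by move=> u v; rewrite fE gE.
Qed.

Lemma tree_inv_subproof f :
  exists k : word m -> word m, [/\ is_tree_aut k, cancel f k & cancel k f].
Proof.
case: (tree_autP f) => [[k fK gK] f0 fE]; exists k; split=> //; split.
- by exists f.
- by rewrite -f0 fK.
- by move=> u v; rewrite [X in _ <-> X]fE !gK.
Qed.

Definition tree_one := TreeAut tree_one_proof.
Definition tree_mul f g := TreeAut (tree_mul_proof f g).
Definition tree_inv f :=
  let: exist _ gP := cid (tree_inv_subproof f) in
  let: And3 gA _ _ := gP in TreeAut gA.

Lemma tree_invK f : cancel f (tree_inv f) /\ cancel (tree_inv f) f.
Proof. by rewrite /tree_inv; case: cid => g []. Qed.

Lemma tree_mulA : associative tree_mul.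
Proof. by move=> f g h; apply: tree_aut_ext. Qed.
Lemma tree_mul1 : left_id tree_one tree_mul.
Proof. by move=> f; apply: tree_aut_ext. Qed.
Lemma tree_mulr1 : right_id tree_one tree_mul.
Proof. by move=> f; apply: tree_aut_ext. Qed.
Lemma tree_mulV : left_inverse tree_one tree_inv tree_mul.
Proof. by move=> f; apply: tree_aut_ext => u /=; case: (tree_invK f). Qed.
Lemma tree_mulrV : right_inverse tree_one tree_inv tree_mul.
Proof. by move=> f; apply: tree_aut_ext => u /=; case: (tree_invK f). Qed.

HB.instance Definition _ := isGroup.Build (tree_aut m)
  tree_mulA tree_mul1 tree_mulr1 tree_mulV tree_mulrV.

Lemma section_proof f u : is_tree_aut (fun z => drop (size u) (f (u ++ z))).
Proof.
have cat h w z := (tree_aut_cat h w z).1.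
have [fK gK] := tree_invK f; set g := tree_inv f in fK gK.
have sz h w : size (h w) = size w.
  exact: (tree_aut_cat h [::] w).2.
apply: is_tree_autI.
- exists (fun z => drop (size u) (g (f u ++ z))) => z.
    by rewrite -cat fK drop_size_cat.
  have := cat g (f u) z; rewrite fK sz => <-; rewrite gK.
  by rewrite drop_size_cat ?sz.
- by rewrite cats0 drop_oversize ?sz.
- move=> z x; have [y] := tree_aut_rcons f (u ++ z) x.
  rewrite -rcons_cat => ->; exists y.
  by rewrite cat rcons_cat !drop_size_cat ?sz.
Qed.

(* The section f_u, characterised by [sectionP]. *)
Definition section f u : tree_aut m := TreeAut (section_proof f u).

Lemma sectionP f u z : f (u ++ z) = f u ++ section f u z.
Proof. exact: (tree_aut_cat f u z).1. Qed.

Definition level_stab (l : nat) : set (tree_aut m) :=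
  [set f | forall u, size u = l -> f u = u].

(* The isomorphism psi is the restriction of this map to [level_stab 1]. *)
Definition psi f : 'I_m -> tree_aut m := fun x => section f [:: x].

Definition level_transitive (G : set (tree_aut m)) : Prop :=
  forall l u v, size u = l -> size v = l -> exists2 g, G g & g u = v.

Definition self_similar (G : set (tree_aut m)) : Prop :=
  forall g u, G g -> G (section g u).

Definition regular_branch_over (G K : set (tree_aut m)) : Prop :=
  [/\ is_subgroup G /\ is_subgroup K,
      level_transitive G /\ self_similar G,
      K <> [set 1%g] /\ K `<=` level_stab 1 `&` G,
      [set h | forall x, K (h x)] `<=` psi @` K
    & finite_index G K].

End TreeAut.

(** * GGS-groups *)

Section GGS.
Variable m : nat.

Definition rooted_fun (w : word m) : word m :=
  if w is x :: z then ordS x :: z else [::].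

Lemma rooted_proof : is_tree_aut rooted_fun.
Proof.
apply: is_tree_autI => //.
- have [s sK Ks] := ordS_bij m.
  exists (fun w => if w is x :: z then s x :: z else [::]); case=> //= x z.
    by rewrite sK.
  by rewrite Ks.
- by case=> [|t z] x; [exists (ordS x) | exists x].
Qed.

Definition ggs_a : tree_aut m := TreeAut rooted_proof.

(* The entry e_i of the defining vector is [e 0 j] with j of value i - 1, and
   'Z_m is Z/mZ as soon as m > 1. The exponent of a power of a is read on the
   representative in [0, m), which is harmless because a has order m. *)
Variable e : 'rV['Z_m]_m.-1.

(* psi(b) = (a^e_1, ..., a^e_(m-1), b): [insub] returns None exactly on the
   last letter x_m. *)
Fixpoint directed_fun (w : word m) : word m :=
  if w is x :: z then
    x :: (if (insub (val x) : option 'I_m.-1) is Some i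
          then (ggs_a ^+ e 0%R i)%g z else directed_fun z)
  else [::].

Lemma directed_proof : is_tree_aut directed_fun.
Proof.
apply: is_tree_autI => //.
- pose fix inv (w : word m) : word m := if w is x :: z then
    x :: (if (insub (val x) : option 'I_m.-1) is Some i
          then tree_inv (ggs_a ^+ e 0%R i)%g z else inv z) else [::].
  exists inv; elim=> //= x z IH; case: insub => [i|]; rewrite ?IH //.
    by case: (tree_invK (ggs_a ^+ e 0%R i)%g) => ->.
  by case: (tree_invK (ggs_a ^+ e 0%R i)%g) => _ ->.
- elim=> [|t z IH] x /=.
    case: insub => [i|]; last by exists x.
    by rewrite tree_aut_nil; exists x.
  case: insub => [i|].
    by have [y ->] := tree_aut_rcons (ggs_a ^+ e 0%R i)%g z x; exists y.
  by have [y ->] := IH x; exists y.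
Qed.

Definition ggs_b : tree_aut m := TreeAut directed_proof.

Lemma ggs_b_stab : level_stab 1 ggs_b.
Proof.
by case=> [|x [|]] //= _; case: insub => // i; rewrite tree_aut_nil.
Qed.

Lemma psi_ggs_b x :
  psi ggs_b x = if (insub (val x) : option 'I_m.-1) is Some i
                then (ggs_a ^+ e 0%R i)%g else ggs_b.
Proof.
by apply: tree_aut_ext => z /=; case: insub => [i|]; rewrite /= drop0.
Qed.

Definition GGS : set (tree_aut m) := gen [set ggs_a; ggs_b].

End GGS.

Section DefiningVectors.
Local Open Scope ring_scope.
Variables p n : nat.

(* pZ/p^nZ *)
Definition pZ_ideal : set 'Z_(p ^ n) := [set p%:R * c | c in [set: 'Z_(p ^ n)]].

Definition calF : set 'rV['Z_(p ^ n)]_(p ^ n).-1 :=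
  [set: 'rV['Z_(p ^ n)]_(p ^ n).-1]
    `\` [set e : 'rV['Z_(p ^ n)]_(p ^ n).-1 | forall i, pZ_ideal (e 0 i)].

(* The set Y, with i shifted by one as for the entries of e. *)
Definition unit_support (e : 'rV['Z_(p ^ n)]_(p ^ n).-1) :
    set 'I_(p ^ n).-1 :=
  [set i | e 0 i <> 0 %[mod p]].

End DefiningVectors.

Arguments calF : clear implicits.

(* Main.v *)
Require Import Defs.
From HB Require Import structures.
From mathcomp Require Import all_boot all_order all_algebra.
From mathcomp Require Import ring.
From mathcomp Require Import boolp classical_sets functions cardinality.

Set Implicit Arguments.
Unset Strict Implicit.
Unset Printing Implicit Defensive.

Import GRing.Theory.

Local Open Scope classical_set_scope.

(** Write [m = p ^ n] and let [c] be the common value of [e] on [Y]. It is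
    prime to [p], a unit modulo [m], so [A = a ^+ c] generates the same subgroup as [a], and
    [G] is generated by [A] and [b]. The sections of [b] at the letters are [b]
    itself, [A] on [Y] and [1] elsewhere. Letters are read in [Z/mZ], and the
    section [w d] is attached to the distance [d] from the letter carrying [b],
    so that [w 0 = b], while the conjugate [beta i] of [b] by a power of [a] has
    the section [w (x - i)] at the letter [x].

    Transitivity, self-similarity and fractality (every element of [G] is the
    section at any given letter of some element of [st_G(1)]) are read off the
    generators. The index is finite because [G / gamma_3(G)] is nilpotent and
    generated by two elements of finite order ([finite_index_lower_central3]).

    The branching property asks for elements of [gamma_3(G)] that have a single
    non-trivial section. The elements [g] that can be this section (at any
    letter: conjugate by [a]) form a subgroup, normalised by [G] by fractality;
    and [gamma_3(G)] is the normal closure of [[~ b, A, A]] and [[~ b, A, b]]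
    ([lower_central3_min]), so these two suffice ([rigid_generators]). For [d] in
    [Y], the commutator of [beta 0] and [beta (- d)] has only two non-trivial
    sections, [[~ b, A]] at [0] and [[~ w (- d), b]] at [- d]. Let [h] in
    [st_G(1)] have sections [h_0] and [h_(-d)] there. The commutator with [h] is
    a single section [[~ b, A, h_0]] at [0] as soon as [h_(-d)] commutes with
    [[~ w (- d), b]] ([rigid_comm]). Let [S] be [Y] together with [0].
    - If [- d] is not in [Y] for some [d] in [Y], then [w (- d) = 1] and [h] is
      arbitrary.
    - If [Y] is symmetric and some [x - d] with [x], [d] in [Y] is outside [S],
      then [beta (- x)] has sections [A] and [1] at [0] and [- d], and the
      quotient of [beta 0] by [beta (x - d)] has sections [b] and [1].
    - Otherwise [S] is a proper subgroup of [Z/mZ], so it does not contain the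
      generator [c]. Then [b] commutes with its conjugate by [A], hence
      [[~ b, A, b]] is trivial, and [h = beta (- d)], with sections [A] and [b],
      yields [[~ b, A, A]].

    Finally [gamma_3(G)] is not trivial: otherwise [a] would commute with the
    commutator of [beta 0] and [beta (- d)], whose sections would all be equal.
    As some are trivial, [b] would commute with [A], then with [a], and its
    sections [b] and [A] would coincide, although [b] fixes the first level. *)

(** * Subgroups, commutators and the third term of the lower central series *)

Section SubgroupTheory.
Local Open Scope group_scope.
Variable gT : groupType.
Implicit Types (s t x y z g : gT) (A G H K M Z : set gT).

Lemma subgroup1 H : is_subgroup H -> H 1.
Proof. by case. Qed.

Lemma subgroupV H x : is_subgroup H -> H x -> H x^-1.
Proof. by case=> H1 HD Hx; rewrite -(mul1g x^-1); apply: HD. Qed.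

Lemma subgroupM H x y : is_subgroup H -> H x -> H y -> H (x * y).
Proof.
move=> sH Hx Hy; rewrite -(invgK y).
by case: (sH) => _; apply=> //; apply: subgroupV.
Qed.

Lemma subgroupX H x i : is_subgroup H -> H x -> H (x ^+ i).
Proof.
move=> sH Hx; elim: i => [|i IH]; first exact: subgroup1.
by rewrite expgS; apply: subgroupM.
Qed.

Lemma subgroupJ H x y : is_subgroup H -> H x -> H y -> H (x ^ y).
Proof.
move=> sH Hx Hy; apply: subgroupM => //; first exact: subgroupV.
exact: subgroupM.
Qed.

Lemma subgroupR H x y : is_subgroup H -> H x -> H y -> H [~ x, y].
Proof.
move=> sH Hx Hy; apply: subgroupM => //; first exact: subgroupV.
exact: subgroupJ.
Qed.

Lemma subgroupI H K : is_subgroup H -> is_subgroup K -> is_subgroup (H `&` K).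
Proof.
move=> [H1 HD] [K1 KD]; split=> // x y [Hx Kx] [Hy Ky].
by split; [apply: HD | apply: KD].
Qed.

Lemma sub_gen A : A `<=` gen A.
Proof. exact: sub_smallest. Qed.

Lemma gen_min A H : is_subgroup H -> A `<=` H -> gen A `<=` H.
Proof. by move=> sH AH x; apply; split. Qed.

Lemma gen_subgroup A : is_subgroup (gen A).
Proof.
split=> [H [[]] //|x y Ax Ay H HA].
by have [[_ HD] _] := HA; apply: HD; [apply: Ax | apply: Ay].
Qed.

Definition normalized_by G H := forall g x, G g -> H x -> H (x ^ g).

Lemma subgroup_normalized G : is_subgroup G -> normalized_by G G.
Proof. by move=> sG g x Gg Gx; apply: subgroupJ. Qed.

Lemma commMgr x y z : [~ x, y * z] = [~ x, z] * [~ x, y] ^ z.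
Proof. by rewrite !commgEl conjMg conjgM conjVg -mulgA mulVKg. Qed.

Lemma commgVr x y : [~ x, y^-1] = ([~ x, y] ^ y^-1)^-1.
Proof.
by rewrite -conjVg invgR !commgEl !conjgE invgK !mulgA mulgV mul1g.
Qed.

(** The commutators with [x] define a centraliser modulo any subgroup [Z]
    normalised by the ambient group: this is what lets properties of
    commutators be checked on generators only. *)
Lemma centralizer_mod_subgroup G Z x : is_subgroup G -> is_subgroup Z ->
  normalized_by G Z -> is_subgroup [set y | G y /\ Z [~ x, y]].
Proof.
move=> sG sZ nZ; split=> [|y z [Gy Zy] [Gz Zz]] /=.
  by rewrite commg1; split; apply: subgroup1.
have GVz : G z^-1 by apply: subgroupV.
split; first exact: subgroupM.
rewrite commMgr commgVr; apply: subgroupM => //; last exact: nZ.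
by apply: subgroupV => //; apply: nZ.
Qed.

Lemma comm_subgroup_normalized G H :
  is_subgroup G -> normalized_by G H -> normalized_by G (comm_subgroup H G).
Proof.
move=> sG nH g x Gg; rewrite /comm_subgroup.
set B := [set _ | _]; suff: gen B `<=` [set x | gen B (x ^ g)] by apply.
have [B1 BD] := gen_subgroup B; apply: gen_min => [|_ [y [z [Hy Gz ->]]]] /=.
  split=> [|y z] /=; first by rewrite conj1g.
  by rewrite conjMg conjVg; apply: BD.
apply: sub_gen; exists (y ^ g), (z ^ g); rewrite conjRg.
by split=> //; [apply: nH | apply: subgroupJ].
Qed.

Lemma lower_central_normalized i G :
  is_subgroup G -> normalized_by G (lower_central i G).
Proof.
move=> sG; rewrite /lower_central; elim: i.-1 => [|j IH] /=.
  exact: subgroup_normalized.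
exact: comm_subgroup_normalized.
Qed.

Lemma lower_central_subgroup i G : is_subgroup G -> is_subgroup (lower_central i G).
Proof. by case: i => [|[|i]] // _; apply: gen_subgroup. Qed.

Lemma mem_lower_central2 G x y : G x -> G y -> lower_central 2 G [~ x, y].
Proof. by move=> Gx Gy; apply: sub_gen; exists x, y. Qed.

Lemma mem_lower_central3 G x y :
  lower_central 2 G x -> G y -> lower_central 3 G [~ x, y].
Proof. by move=> Gx Gy; apply: sub_gen; exists x, y. Qed.

(** Modulo [M] the commutator [[~ t, s]] is central. Modulo the centre the
    generators therefore commute, hence so do all elements of the group: the
    quotient by [M] is nilpotent of class at most two. *)
Lemma lower_central3_min s t M (G := gen [set s; t]) :
    is_subgroup M -> normalized_by G M ->
    M [~ t, s, s] -> M [~ t, s, t] ->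
  lower_central 3 G `<=` M.
Proof.
move=> sM nM Ms Mt; have sG : is_subgroup G by apply: gen_subgroup.
have GP H : is_subgroup H -> H s -> H t -> G `<=` H.
  by move=> sH Hs Ht; apply: gen_min => // _ [] ->.
have [Gs Gt] : G s /\ G t by split; apply: sub_gen; [left | right].
clearbody G.
have comm_sym Z x y : is_subgroup Z -> Z [~ x, y] -> Z [~ y, x].
  by move=> sZ; rewrite -(invgR x y); apply: subgroupV.
(* [Z] is the inverse image of the centre of the quotient by [M]. *)
pose Z := [set z | G z /\ forall g, G g -> M [~ z, g]].
have sZ : is_subgroup Z.
  split=> [|y z [Gy Zy] [Gz Zz]] /=.
    by split=> [|g _]; rewrite ?comm1g; [apply: subgroup1 sG | apply: subgroup1 sM].
  split=> [|g Gg]; first by apply: sG.2.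
  have [_ CD] := centralizer_mod_subgroup g sG sM nM.
  have [||_] := CD y z; last exact: comm_sym sM.
    by split=> //; apply: comm_sym sM _; apply: Zy.
  by split=> //; apply: comm_sym sM _; apply: Zz.
have nZ : normalized_by G Z.
  move=> g z Gg [Gz Zz]; split=> [|h Gh]; first exact: subgroupJ.
  rewrite -(conjgKV g h) -conjRg; apply: nM => //; apply: Zz.
  by apply: subgroupJ => //; apply: subgroupV.
have Zts : Z [~ t, s].
  split=> [|g Gg]; first exact: subgroupR.
  have [] // := GP _ (centralizer_mod_subgroup [~ t, s] sG sM nM) _ _ g Gg.
have Zgen x : Z [~ x, s] -> Z [~ x, t] -> forall y, G y -> Z [~ x, y].
  move=> Zs Zt y Gy.
  by have [] := GP _ (centralizer_mod_subgroup x sG sZ nZ) _ _ y Gy.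
have Zs := Zgen s; rewrite commgg in Zs.
have {}Zs := Zs (subgroup1 sZ) (comm_sym _ _ _ sZ Zts).
have Zt := Zgen t Zts; rewrite commgg in Zt; have {}Zt := Zt (subgroup1 sZ).
have ZG x y : G x -> G y -> Z [~ x, y].
  move=> Gx Gy; apply: Zgen => //; apply: comm_sym => //.
    exact: Zs.
  exact: Zt.
apply: gen_min => // _ [x [y [G2x Gy ->]]].
suff [_] : Z x by apply.
by apply: (gen_min sZ _ G2x) => _ [u [v [Gu Gv ->]]]; apply: ZG.
Qed.

Lemma expg_modn x m i : x ^+ m = 1 -> x ^+ (i %% m) = x ^+ i.
Proof.
move=> xm1; rewrite {2}(divn_eq i m) expgnDr mulnC expgnA xm1.
by rewrite expg1n mul1g.
Qed.

(** Modulo [gamma_3] every element of [gen [set s; t]] takes the form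
    [s ^+ i * t ^+ j * c ^+ k] with [c = [~ t, s]] central: the right
    multiplications by [s] and [t] only change the exponents. Moreover
    [t ^+ m = 1] forces the order of [c] to divide [m] as well, so there are
    finitely many cosets. *)
Lemma finite_index_lower_central3 s t m (G := gen [set s; t]) :
  (0 < m)%N -> s ^+ m = 1 -> t ^+ m = 1 -> finite_index G (lower_central 3 G).
Proof.
move=> m0 sm tm; have sG : is_subgroup G by apply: gen_subgroup.
have GP H : is_subgroup H -> H s -> H t -> G `<=` H.
  by move=> sH Hs Ht; apply: gen_min => // _ [] ->.
have [Gs Gt] : G s /\ G t by split; apply: sub_gen; [left | right].
clearbody G.
have sK : is_subgroup (lower_central 3 G) by apply: lower_central_subgroup.
have nK : normalized_by G (lower_central 3 G) by apply: lower_central_normalized.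
have Kts g : G g -> lower_central 3 G [~ t, s, g].
  by move=> Gg; apply: mem_lower_central3 => //; apply: mem_lower_central2.
move: (lower_central 3 G) sK nK Kts => K sK nK Kts.
pose E x y := K (x^-1 * y).
have Exx x : E x x by rewrite /E mulVg; apply: subgroup1.
have Esym x y : E x y -> E y x.
  by move/(subgroupV sK); rewrite invgM invgK.
have Etr y x z : E x y -> E y z -> E x z.
  by move=> Exy /(subgroupM sK Exy); rewrite mulgA mulgK.
have El z x y : E x y -> E (z * x) (z * y).
  by rewrite /E invgM -mulgA mulKg.
have Er z x y : G z -> E x y -> E (x * z) (y * z).
  by move=> Gz /(nK _ _ Gz); rewrite /E conjgE invgM !mulgA.
have [c [Gc tsE Kc]] : exists c,
    [/\ G c, t * s = s * t * c & forall g, G g -> K [~ c, g]].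
  by exists [~ t, s]; split=> //; [apply: subgroupR | apply: commgC].
have Ec k g : G g -> E (c ^+ k * g) (g * c ^+ k).
  move=> Gg; suff : K [~ g, c ^+ k] by rewrite /E commgEl conjgE invgM !mulgA.
  have sC := centralizer_mod_subgroup g sG sK nK.
  have [] // := subgroupX k sC (_ : [set y | G y /\ K [~ g, y]] c).
  split=> //.
  by rewrite -(invgR c); apply: subgroupV => //; apply: Kc.
have GX x i : G x -> G (x ^+ i) by move=> Gx; apply: subgroupX.
have Etjs j : E (t ^+ j * s) (s * t ^+ j * c ^+ j).
  elim: j => [|j IH]; first by rewrite !expg0 !mulg1 mul1g; apply: Exx.
  rewrite expgS -mulgA; apply: (Etr _ _ _ (El t _ _ IH)).
  rewrite !mulgA tsE -!mulgA; apply/El/El; rewrite !mulgA.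
  rewrite (expgS c) mulgA; apply/Er; first exact: GX.
  by have := Ec 1%N (t ^+ j) (GX _ _ Gt); rewrite expg1.
have Kcm : K (c ^+ m).
  by have := Etjs m; rewrite tm mul1g mulg1 /E mulKg.
pose F i j k := s ^+ i * t ^+ j * c ^+ k.
pose T := [set g | exists i j k, E (F i j k) g].
have Ts g : T g -> T (g * s).
  case=> i [j [k /(Er _ _ _ Gs) Eg]].
  exists i.+1, j, (j + k)%N; apply: (Etr _ _ _ _ Eg); apply: (Esym).
  rewrite /F -!mulgA expgSr -!mulgA; apply/El.
  apply: (Etr (t ^+ j * (s * c ^+ k))); first by apply/El/Ec.
  rewrite expgnDr !mulgA; apply/Er; first exact: GX.
  exact: Etjs.
have Tt g : T g -> T (g * t).
  case=> i [j [k /(Er _ _ _ Gt) Eg]].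
  exists i, j.+1, k; apply: (Etr _ _ _ _ Eg); apply: (Esym).
  rewrite /F -!mulgA expgSr -!mulgA; apply/El/El.
  exact: Ec.
have TX x g i : (forall h, T h -> T (h * x)) -> T g -> T (g * x ^+ i).
  move=> Tx Tg; elim: i => [|i IH]; first by rewrite mulg1.
  by rewrite expgSr mulgA; apply: Tx.
have inv_pred x : x ^+ m = 1 -> x^-1 = x ^+ m.-1.
  by move=> xm; rewrite -[LHS]mulg1 -xm -(prednK m0) expgS mulKg.
have GT : G `<=` T.
  (* With an implication alone this set need not be closed under inverses. *)
  suff GN : G `<=` [set g | forall h, T h <-> T (h * g)].
    move=> g /GN /(_ 1); rewrite mul1g => -[+ _]; apply.
    by exists 0%N, 0%N, 0%N; rewrite /F !expg0 !mulg1; apply: Exx.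
  have NT x : x ^+ m = 1 -> (forall h, T h -> T (h * x)) ->
      forall h, T h <-> T (h * x).
    move=> xm Tx h; split=> [|Th]; first exact: Tx.
    by rewrite -(mulgK x h) inv_pred //; apply: TX.
  apply: GP; [|exact: NT|exact: NT].
  split=> [h|x y Nx Ny h] /=; first by rewrite mulg1.
  by rewrite (Ny (h * _)) mulgA mulgVK.
pose coset (u : nat * nat * nat) := [set F u.1.1 u.1.2 u.2 * k | k in K].
apply: (@sub_finite_set _ _ (coset @` (`I_m `*` `I_m `*` `I_m))); last first.
  by apply: finite_image; do 2!apply: finite_setX => //.
move=> _ [g /GT[i [j [k Eg]]] ->].
exists ((i %% m, j %% m), k %% m)%N; first by rewrite /= !ltn_mod.
have {Eg} Eg : E (F (i %% m)%N (j %% m)%N (k %% m)%N) g.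
  apply: (Etr _ _ _ _ Eg); rewrite /F (expg_modn i sm) (expg_modn j tm); apply/El.
  rewrite {2}(divn_eq k m) addnC expgnDr mulnC expgnA /E mulKg.
  exact: subgroupX.
rewrite /coset /=; move: (F _ _ _) Eg => f Eg; apply/seteqP; split=> _ [k' Kk <-].
  exists (g^-1 * f * k'); last by rewrite -!mulgA mulVKg.
  by apply: subgroupM => //; apply: Esym.
exists (f^-1 * g * k'); last by rewrite -!mulgA mulVKg.
exact: subgroupM.
Qed.

End SubgroupTheory.

(** * Tree automorphisms given by their first-level sections *)

Section Diagonal.
Local Open Scope group_scope.
Variable m : nat.
Implicit Types (h k : 'I_m -> tree_aut m) (f g : tree_aut m) (u z : word m).

Definition diag_fun h (w : word m) : word m :=
  if w is x :: z then x :: h x z else [::].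

Lemma diag_proof h : is_tree_aut (diag_fun h).
Proof.
apply: is_tree_autI => //.
- exists (diag_fun (fun x => tree_inv (h x))); case=> //= x z.
    by case: (tree_invK (h x)) => ->.
  by case: (tree_invK (h x)) => _ ->.
- case=> [|t z] x /=; first by exists x; rewrite tree_aut_nil.
  by have [y ->] := tree_aut_rcons (h t) z x; exists y.
Qed.

(** The inverse of the isomorphism [psi]. *)
Definition diag h : tree_aut m := TreeAut (diag_proof h).

Lemma psi_diag h : psi (diag h) = h.
Proof. by apply/funext => x; apply: tree_aut_ext => z /=; rewrite drop0. Qed.

Lemma diag_stab h : level_stab 1 (diag h).
Proof. by case=> [|x [|]] //= _; rewrite tree_aut_nil. Qed.

Lemma diag_psi f : level_stab 1 f -> diag (psi f) = f.
Proof.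
move=> f1; apply: tree_aut_ext => -[|x z]; first by rewrite !tree_aut_nil.
by rewrite -[x :: z]/([:: x] ++ z) (sectionP f) f1.
Qed.

Lemma eq_diag h k : h =1 k -> diag h = diag k.
Proof. by move/funext->. Qed.

Lemma diagM h k : diag h * diag k = diag (fun x => h x * k x).
Proof. by apply: tree_aut_ext; case. Qed.

Lemma diag1 : diag (fun=> 1) = 1.
Proof. by apply: tree_aut_ext; case. Qed.

Lemma diagV h : (diag h)^-1 = diag (fun x => (h x)^-1).
Proof.
apply: (mulgI (diag h)); rewrite mulgV diagM -diag1.
by apply: eq_diag => x; rewrite mulgV.
Qed.

Lemma diagX h n : diag h ^+ n = diag (fun x => h x ^+ n).
Proof.
elim: n => [|n IH]; first by rewrite expg0 -diag1.
by rewrite expgS IH diagM; apply: eq_diag => x; rewrite expgS.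
Qed.

Lemma diagJ h k : diag h ^ diag k = diag (fun x => h x ^ k x).
Proof. by rewrite conjgE diagV !diagM. Qed.

Lemma diagR h k : [~ diag h, diag k] = diag (fun x => [~ h x, k x]).
Proof. by rewrite commgEl diagJ diagV diagM. Qed.

Lemma level_stab_subgroup l : is_subgroup (@level_stab m l).
Proof.
split=> // f g f1 g1 u ul.
by rewrite -[LHS]/(tree_inv g (f u)) f1 // -{1}(g1 u ul) (tree_invK g).1.
Qed.

Lemma size_tree_aut f u : size (f u) = size u.
Proof. exact: (tree_aut_cat f [::] u).2. Qed.

Lemma level_stab_normalized l G : normalized_by G (@level_stab m l).
Proof.
move=> g f _ fl u ul; rewrite -[LHS]/(g (f (tree_inv g u))).
by rewrite fl ?size_tree_aut // (tree_invK g).2.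
Qed.

Lemma sectionM f g u : section (f * g) u = section f u * section g (f u).
Proof.
apply: tree_aut_ext => z; rewrite /= {1}(tree_aut_cat f u z).1.
by rewrite !size_tree_aut.
Qed.

Lemma section1 u : section 1 u = 1.
Proof. by apply: tree_aut_ext => z /=; rewrite drop_size_cat. Qed.

Lemma section_nil f : section f [::] = f.
Proof. by apply: tree_aut_ext => z /=; rewrite drop0. Qed.

Lemma section_diag h x u : section (diag h) (x :: u) = section (h x) u.
Proof. by apply: tree_aut_ext. Qed.

(** Self-similarity of a group only has to be checked on generators. *)
Lemma self_similar_elements_subgroup G : is_subgroup G ->
  is_subgroup [set g : tree_aut m | forall u, G (section g u)].
Proof.
move=> sG; split=> [u|f g Gf Gg u] /=; first by rewrite section1; apply: subgroup1.
rewrite sectionM; apply: subgroupM => //; move: (f u) => v.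
have := section1 v; rewrite -{1}(mulVg g) sectionM => /eqP.
by rewrite mulg_eq1 => /eqP ->; apply: subgroupV.
Qed.

(** A fractal group acting transitively on the letters is transitive on every
    level: once the first letter is right, the section there can be
    prescribed. *)
Lemma fractal_level_transitive G : is_subgroup G ->
    (forall x y, exists2 g : tree_aut m, G g & g [:: x] = [:: y]) ->
    (forall x (g : tree_aut m), G g -> exists2 h, G (diag h) & h x = g) ->
  level_transitive G.
Proof.
move=> sG tG fG; elim=> [|l IH] u v.
  by move=> /size0nil-> /size0nil->; exists 1 => //; apply: subgroup1.
case: u v => [|x u] [|y v] //= [ul] [vl].
have [g Gg gx] := tG x y.
have [k Gk kE] := IH (section g [:: x] u) v (etrans (size_tree_aut _ _) ul) vl.
have [h Gh hy] := fG y k Gk.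
exists (g * diag h); first exact: subgroupM.
rewrite -[LHS]/(diag h (g ([:: x] ++ u))) (sectionP g) gx /=.
by rewrite hy kE.
Qed.

Definition single x g : 'I_m -> tree_aut m := fun y => if y == x then g else 1.

Lemma diag_single1 x : diag (single x 1) = 1.
Proof.
by rewrite -[RHS]diag1; apply: eq_diag => y; rewrite /single if_same.
Qed.

Lemma diag_singleM x f g :
  diag (single x f) * diag (single x g) = diag (single x (f * g)).
Proof.
rewrite diagM; apply: eq_diag => y.
by rewrite /single; case: eqP; rewrite ?mulg1.
Qed.

Lemma diag_singleV x g : (diag (single x g))^-1 = diag (single x g^-1).
Proof.
rewrite diagV; apply: eq_diag => y.
by rewrite /single; case: eqP; rewrite ?invg1.
Qed.

(** Every element of [st(1)] is the product of its first-level coordinates. *)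
Lemma diag_of_singles H h : is_subgroup H ->
  (forall x, H (diag (single x (h x)))) -> H (diag h).
Proof.
move=> sH Hh.
suff D (s : seq 'I_m) : uniq s -> H (diag (fun x => if x \in s then h x else 1)).
  have := D _ (enum_uniq 'I_m); congr H; apply: eq_diag => x.
  by rewrite mem_enum.
elim: s => [_|y s IH /= /andP[yNs us]].
  by rewrite (@eq_diag _ (fun=> 1)) // diag1; apply: subgroup1.
have := subgroupM sH (Hh y) (IH us); rewrite diagM; congr H.
apply: eq_diag => x; rewrite /single inE; case: eqP => [->|_] /=.
  by rewrite (negPf yNs) mulg1.
by rewrite mul1g.
Qed.

End Diagonal.

(** * Conjugation by the rooted automorphism *)

Section Rooted.
Local Open Scope ring_scope.
Variable q : nat.
Notation m := q.+2.
Implicit Types (h : 'I_m -> tree_aut m) (x y i : 'I_m) (n : nat).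
Notation a := (ggs_a m).

Lemma ordSE x : ordS x = x + 1.
Proof. by apply: val_inj; rewrite /= modnDmr addn1. Qed.

Lemma ggs_aX n x z : (a ^+ n)%g (x :: z) = (x + n%:R) :: z.
Proof.
elim: n x => [|n IH] x; first by rewrite addr0.
rewrite expgS -[LHS]/((a ^+ n)%g (ordS x :: z)) ordSE IH.
by rewrite -addrA -natr1 (addrC 1).
Qed.

Lemma eq_ggs_aX n n' : n%:R = n'%:R :> 'I_m -> (a ^+ n)%g = (a ^+ n')%g.
Proof.
move=> nn'; apply: tree_aut_ext => -[|x z]; first by rewrite !tree_aut_nil.
by rewrite !ggs_aX nn'.
Qed.

Lemma ggs_a_order : (a ^+ m)%g = 1%g.
Proof. by apply: (@eq_ggs_aX _ 0); apply: (@pchar_Zp m). Qed.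

Lemma diag_conj_rooted h n :
  (diag h ^ (a ^+ n))%g = diag (fun x => h (x - n%:R)).
Proof.
apply: (mulgI (a ^+ n)%g); rewrite -conjgC.
apply: tree_aut_ext => -[|x z]; first by rewrite !tree_aut_nil.
rewrite -[LHS]/((a ^+ n)%g (x :: h x z)) ggs_aX.
rewrite -[RHS]/(diag (fun y => h (y - n%:R)) ((a ^+ n)%g (x :: z))).
by rewrite ggs_aX /= addrK.
Qed.

Lemma section_ggs_aX n u : exists n', section (a ^+ n)%g u = (a ^+ n')%g.
Proof.
case: u => [|x u]; first by exists n; rewrite section_nil.
exists 0%N; apply: tree_aut_ext => z; rewrite /= ggs_aX /=.
by rewrite drop_size_cat.
Qed.

End Rooted.

(** * GGS-groups whose defining vector takes one non-zero value, a unit *)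

Section ConstantOnSupport.
Local Open Scope ring_scope.
Variables (q : nat) (b : tree_aut q.+2) (w : 'I_q.+2 -> tree_aut q.+2).
Variables (c : 'I_q.+2) (k : nat) (Y : pred 'I_q.+2).
Notation m := q.+2.
Notation a := (ggs_a m).
Notation A := ((a ^+ c)%g : tree_aut m).
Implicit Types (i j d x y : 'I_m) (h : 'I_m -> tree_aut m) (f g : tree_aut m).
(* [c] is invertible, which is what makes [A] generate the group of [a]. *)
Hypothesis ck1 : c * k%:R = 1.
(* [b] recurs at the last letter, of value [m - 1 = - 1]: hence the shift. *)
Hypothesis psi_b : b = diag (fun x => w (x + 1)).
Hypotheses (Y0 : ~~ Y 0) (w0 : w 0 = b).
Hypothesis wY : forall d, Y d -> w d = A.
Hypothesis wN : forall d : 'I_m, d != 0 -> ~~ Y d -> w d = 1%g.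
Hypotheses (Yex : exists d, Y d) (Nex : exists2 d : 'I_m, d != 0 & ~~ Y d).

Notation G := (gen [set a; b]).
Notation K := (lower_central 3 G).

Lemma aE : a = (A ^+ k)%g.
Proof.
rewrite -expgnA -[LHS]expg1; apply: eq_ggs_aX.
by rewrite natrM natr_Zp.
Qed.

Lemma GE : G = gen [set A; b].
Proof.
have sgX f g (n : nat) : gen [set f; g] (f ^+ n)%g.
  by apply: (subgroupX n (@gen_subgroup _ _)); apply: sub_gen; left.
apply/seteqP; split; (apply: gen_min; first exact: gen_subgroup) => _ [] ->.
- by rewrite [X in gen _ X]aE; apply: sgX.
- by apply: sub_gen; right.
- exact: sgX.
- by apply: sub_gen; right.
Qed.

Let sG : is_subgroup G. Proof. exact: gen_subgroup. Qed.
Let Ga : G a. Proof. by apply: sub_gen; left. Qed.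
Let Gb : G b. Proof. by apply: sub_gen; right. Qed.
Let GaX n : G (a ^+ n)%g. Proof. exact: (subgroupX n sG Ga). Qed.
Let sK : is_subgroup K. Proof. exact: lower_central_subgroup. Qed.
Let nK : normalized_by G K. Proof. exact: lower_central_normalized. Qed.

Lemma G_ind H : is_subgroup H -> H A -> H b -> G `<=` H.
Proof. by move=> sH HA Hb; rewrite GE; apply: gen_min => // _ [] ->. Qed.

(** [b] is a section of itself, so this is an induction on words. *)
Lemma b_order : (b ^+ m)%g = 1%g.
Proof.
apply: tree_aut_ext; elim=> [|x z IH]; first by rewrite tree_aut_nil.
rewrite {1}psi_b diagX -[LHS]/(x :: (w (x + 1) ^+ m)%g z).
congr (_ :: _); move: (x + 1) => d.
have [->|d0] := eqVneq d 0; first by rewrite w0.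
have [/wY->|/(wN d0)->] := boolP (Y d); last by rewrite expg1n.
by rewrite expgnAC ggs_a_order expg1n.
Qed.

(** The conjugate of [b] by a power of [a] that has [b] as its section at the
    letter [i]. *)
Definition beta i : tree_aut m := diag (fun x => w (x - i)).

Lemma betaE i : beta i = (b ^ (a ^+ val (i + 1)))%g.
Proof.
rewrite psi_b diag_conj_rooted; apply: eq_diag => x.
by congr w; rewrite natr_Zp; ring.
Qed.

Lemma mem_beta i : G (beta i).
Proof. by rewrite betaE; apply: (subgroupJ sG Gb (GaX _)). Qed.

(** The generators are obtained: [beta x] has the section [b] at [x] and, since
    [Y] is not empty, some other [beta i] has the section [A] there. *)
Lemma fractal x g : G g -> exists2 h, G (diag h) & h x = g.
Proof.
move: g; apply: G_ind.
- split=> [|_ _ [h Gh <-] [h' Gh' <-]] /=.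
    by exists (fun=> 1%g) => //; rewrite diag1; apply: (subgroup1 sG).
  exists (fun y => h y * (h' y)^-1)%g => //.
  rewrite -diagM -diagV; apply: (subgroupM sG Gh).
  exact: (subgroupV sG Gh').
- have [d Yd] := Yex; exists (fun y => w (y - (x - d))); first exact: mem_beta.
  by rewrite (_ : _ - _ = d) ?wY //; ring.
- by exists (fun y => w (y - x)); [apply: mem_beta | rewrite subrr].
Qed.

Lemma G_level_transitive : level_transitive G.
Proof.
apply: fractal_level_transitive => // [x y|]; last exact: fractal.
exists (a ^+ val (y - x))%g => //.
by rewrite ggs_aX natr_Zp addrC subrK.
Qed.

Lemma G_self_similar : self_similar G.
Proof.
suff GS : G `<=` [set g : tree_aut m | forall u, G (section g u)].
  by move=> g u /GS.
have aS n : [set g : tree_aut m | forall u, G (section g u)] (a ^+ n)%g.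
  by move=> u /=; have [n' ->] := section_ggs_aX n u.
apply: G_ind => [||u /=]; first exact: self_similar_elements_subgroup.
  exact: aS.
elim: u => [|x u IH]; first by rewrite section_nil.
rewrite [in section _ _]psi_b section_diag; move: (x + 1) => d.
have [->|d0] := eqVneq d 0; first by rewrite w0.
have [/wY->|/(wN d0)->] := boolP (Y d); first exact: aS.
by rewrite section1; apply: (subgroup1 sG).
Qed.

Lemma gamma3_stab : K `<=` level_stab 1 `&` G.
Proof.
have Sb : level_stab 1 b by rewrite psi_b; apply: diag_stab.
have sS := @level_stab_subgroup m 1.
have SR f g : level_stab 1 f -> level_stab 1 [~ f, g]%g.
  move=> Sf; apply: (subgroupM sS (subgroupV sS Sf)).
  exact: (level_stab_normalized (G := setT)).
have GA : G A by apply: GaX.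
rewrite GE; apply: lower_central3_min; rewrite -?GE.
- exact: subgroupI.
- move=> g f Gg [Sf Gf]; split; first exact: (level_stab_normalized Gg).
  exact: (subgroupJ sG).
- by split; [apply/SR/SR | do 2!apply: (subgroupR sG) => //].
- by split; [apply/SR/SR | do 2!apply: (subgroupR sG) => //].
Qed.

(** * Elements of [gamma_3] with a single non-trivial section *)

(** The sections of the elements of [gamma_3] supported at one letter: the rigid
    vertex stabilisers of the first level inside [gamma_3]. *)
Definition rigid g : Prop := forall x, K (diag (single x g)).

Lemma rigid_at x g : K (diag (single x g)) -> rigid g.
Proof.
move=> Kg y; have := nK (GaX (val (y - x))) Kg.
rewrite diag_conj_rooted natr_Zp; congr K; apply: eq_diag => z.
rewrite /single; congr (if _ then _ else _).
by rewrite subr_eq addrC subrK.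
Qed.

Lemma rigid_subgroup : is_subgroup rigid.
Proof.
split=> [x|f g Rf Rg x].
  by rewrite diag_single1; apply: (subgroup1 sK).
rewrite -diag_singleM -diag_singleV; apply: (subgroupM sK (Rf x)).
exact: (subgroupV sK (Rg x)).
Qed.

Lemma rigid_normalized : normalized_by G rigid.
Proof.
move=> g f Gg Rf x; have [h Gh <-] := fractal x Gg.
have := nK Gh (Rf x); rewrite diagJ; congr K; apply: eq_diag => y.
by rewrite /single; case: eqP => [->|]; rewrite ?conj1g.
Qed.

(** Away from [i] and [j] the sections of [beta i] and [beta j] are powers of
    the same element. *)
Lemma comm_w_off i j x : x != i -> x != j -> [~ w (x - i), w (x - j)]%g = 1%g.
Proof.
rewrite -(subr_eq0 x i) -(subr_eq0 x j); move: (_ - i) (_ - j) => d d' d0 d'0.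
have [/wY->|/(wN d0)->] := boolP (Y d); last by rewrite comm1g.
by have [/wY->|/(wN d'0)->] := boolP (Y d'); rewrite ?commgg ?commg1.
Qed.

(** [[~ beta 0, beta (- d)]] has the section [[~ b, A]] at the letter [0], the
    section [[~ w (- d), b]] at [- d], and trivial sections elsewhere; the
    hypothesis on [h] kills the second one. *)
Lemma rigid_comm d h : Y d -> G (diag h) ->
  [~ w (- d), b, h (- d)]%g = 1%g -> rigid [~ b, A, h 0]%g.
Proof.
move=> Yd Gh hd.
have Kd : K [~ beta 0, beta (- d), diag h]%g.
  by apply: mem_lower_central3 => //; apply: mem_lower_central2; apply: mem_beta.
apply: (@rigid_at 0); move: Kd; rewrite /beta !diagR; congr K.
apply: eq_diag => x; rewrite /single.
have [->|x0] := eqVneq x 0; first by rewrite subr0 opprK add0r w0 (wY Yd).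
have [->|xd] := eqVneq x (- d); first by rewrite subr0 subrr w0.
by rewrite comm_w_off // comm1g.
Qed.

Definition supp0 : pred 'I_m := fun d => (d == 0) || Y d.

(** The three cases depend on how far [Y] with [0] added is from a subgroup of
    [Z/mZ]. *)
Lemma rigid_generators : rigid [~ b, A, A]%g /\ rigid [~ b, A, b]%g.
Proof.
have R1 : rigid 1%g by apply: (subgroup1 rigid_subgroup).
have rigidA d : Y d -> [~ w (- d), b]%g = 1%g ->
    rigid [~ b, A, A]%g /\ rigid [~ b, A, b]%g.
  move=> Yd wd; split.
    have [h Gh h0] := fractal 0 (GaX c); have := rigid_comm Yd Gh.
    by rewrite h0; apply; rewrite wd comm1g.
  have [h Gh h0] := fractal 0 Gb; have := rigid_comm Yd Gh.
  by rewrite h0; apply; rewrite wd comm1g.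
have [/existsP[d /andP[Yd YNd]]|YN] := boolP [exists d, Y d && ~~ Y (- d)].
  apply: (rigidA d Yd); rewrite wN ?comm1g // oppr_eq0.
  by apply: contraNneq Y0 => <-.
have {}YN d : Y (- d) = Y d.
  suff YN' d' : Y d' -> Y (- d') by apply/idP/idP => /YN'; rewrite ?opprK.
  by move=> Yd'; move: YN; rewrite negb_exists => /forallP/(_ d'); rewrite Yd' negbK.
have SN d : supp0 (- d) = supp0 d by rewrite /supp0 oppr_eq0 YN.
have wS d : ~~ supp0 d -> w d = 1%g by rewrite negb_or => /andP[]; apply: wN.
have [|] := boolP [exists d, exists x, [&& Y d, Y x & ~~ supp0 (x - d)]].
  case/existsP=> d /existsP[x /and3P[Yd Yx xd]]; split.
    have := @rigid_comm d (fun y => w (y - - x)) Yd (mem_beta _).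
    rewrite opprK add0r (wY Yx) (addrC (- d)) (wS _ xd) commg1; exact.
  have Gh : G (diag (fun y => w (y - 0) * (w (y - (x - d)))^-1)%g).
    rewrite -diagM -diagV; apply: (subgroupM sG (mem_beta _)).
    exact: (subgroupV sG (mem_beta _)).
  have := @rigid_comm d _ Yd Gh; rewrite !subr0 sub0r opprB w0.
  rewrite (wS (d - x)); last by rewrite -opprB SN.
  rewrite invg1 mulg1; apply; rewrite addKr.
  by rewrite !wY ?YN // mulgV commg1.
(* [supp0] is a subgroup, and it is proper. *)
rewrite negb_exists => /forallP Sclosed.
have {}Sclosed x y : supp0 x -> supp0 y -> supp0 (x - y).
  move=> /orP[/eqP->|Yx]; first by rewrite sub0r SN.
  move=> /orP[/eqP->|Yy]; first by rewrite subr0 /supp0 Yx orbT.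
  move: (Sclosed y); rewrite negb_exists => /forallP/(_ x).
  by rewrite Yx Yy /= negbK.
have ScX : supp0 c -> forall n, supp0 (c *+ n).
  move=> Sc; elim=> [|n IH]; first by rewrite /supp0 eqxx.
  by rewrite mulrSr -[X in supp0 (_ + X)]opprK Sclosed ?SN.
(* Otherwise [supp0] would contain the multiples of [c], that is, everything. *)
have cNS : ~~ supp0 c.
  have [d d0 YNd] := Nex; apply/negP => /ScX/(_ (k * d)%N).
  rewrite -mulr_natr natrM mulrA ck1 mul1r natr_Zp /supp0.
  by rewrite (negPf d0) (negPf YNd).
have bA1 : [~ b, A, b]%g = 1%g.
  have bbA : commute b (b ^ A)%g.
    apply/commgP/eqP.
    (* [b] and its conjugate are [beta (- 1)] and [beta (c - 1)]. *)
    rewrite {2}psi_b diag_conj_rooted natr_Zp psi_b diagR -diag1.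
    apply: eq_diag => x.
    have [->|x1] := eqVneq x (- 1).
      by rewrite addrAC addNr add0r (wS (- c)) ?SN // commg1.
    have [->|xc] := eqVneq x (c - 1).
      by rewrite subrK (wS c) // comm1g.
    rewrite addrAC (_ : x + 1 = x - - 1); last by rewrite opprK.
    rewrite (_ : _ - c = x - (c - 1)); last by ring.
    exact: comm_w_off.
  apply/eqP; rewrite commg1_sym commgEl; apply/commgP.
  by apply: commuteM => //; apply: commuteV; apply: commute_refl.
split; last by rewrite bA1.
have [d Yd] := Yex.
have := @rigid_comm d (fun y => w (y - - d)) Yd (mem_beta _).
rewrite opprK add0r addNr w0 (wY Yd); apply; rewrite wY ?YN //.
apply/eqP; rewrite commg1_sym -(invgR b A); apply/commgP/commuteV/commute_sym/commgP.
by rewrite bA1.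
Qed.

Lemma gamma3_rigid : K `<=` rigid.
Proof.
have [RA Rb] := rigid_generators; rewrite {1}GE; apply: lower_central3_min => //.
  exact: rigid_subgroup.
by rewrite -GE; apply: rigid_normalized.
Qed.

Lemma gamma3_neq1 : K <> [set 1%g].
Proof.
move=> K1; have [d Yd] := Yex; have [d' d'0 YNd'] := Nex.
have bA1 : [~ b, A]%g = 1%g.
  have hE : [~ beta 0, beta (- d)]%g =
      diag (fun x => [~ w (x - 0), w (x - - d)]%g) by rewrite /beta diagR.
  set h := fun _ => _ in hE.
  have ha : [~ diag h, a]%g = 1%g.
    suff : K [~ diag h, a]%g by rewrite K1.
    apply: mem_lower_central3 => //; rewrite -hE.
    by apply: mem_lower_central2; apply: mem_beta.
  (* Conjugation by [a] shifts the sections, so they are all equal. *)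
  have hcst x : h x = h 0.
    have : (diag h ^ (a ^+ val x))%g = diag h.
      by apply/conjg_fixP/commgP/commuteX/commgP; rewrite ha.
    rewrite diag_conj_rooted natr_Zp => /(congr1 (@psi _)).
    by rewrite !psi_diag => /(congr1 (@^~ x)) <-; rewrite subrr.
  (* A letter where the section of the commutator is trivial. *)
  have [t [t0 td]] : exists t : 'I_m, t != 0 /\ t != - d.
    have [d'E|] := eqVneq d' (- d); last by exists d'.
    exists d; split; first by apply: contraTneq Yd => ->.
    by rewrite -d'E; apply: contraTneq Yd => ->.
  have := hcst t; rewrite /h comm_w_off // subr0 opprK add0r w0.
  by rewrite (wY Yd).
(* Now all the sections of [b] are equal as well. *)
have bX (n : nat) : (b ^ (a ^+ n))%g = b.
  apply/conjg_fixP/commgP/commuteX; rewrite aE; apply/commuteX/commgP.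
  by rewrite bA1.
have bA : b = A.
  have := bX (val d); rewrite {2}psi_b {1}psi_b diag_conj_rooted natr_Zp.
  move=> /(congr1 (@psi _)); rewrite !psi_diag => /(congr1 (@^~ (d - 1))) /=.
  by rewrite subrK addrAC subrK subrr w0 wY.
have : level_stab 1 b by rewrite psi_b; apply: diag_stab.
move=> /(_ [:: 0] erefl); rewrite bA ggs_aX natr_Zp add0r.
move=> /(congr1 (head 0)) /= c0; move: ck1; rewrite c0.
by rewrite mul0r => /esym/eqP; rewrite oner_eq0.
Qed.

Lemma regular_branch_over_gamma3 : regular_branch_over G K.
Proof.
split=> //.
- split; [exact: G_level_transitive | exact: G_self_similar].
- split; [exact: gamma3_neq1 | exact: gamma3_stab].
- move=> h Kh; exists (diag h); last exact: psi_diag.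
  by apply: diag_of_singles => // x; apply: gamma3_rigid.
rewrite GE; apply: (@finite_index_lower_central3 _ _ _ m) => //.
  by rewrite expgnAC ggs_a_order expg1n.
exact: b_order.
Qed.

End ConstantOnSupport.

(** The inverse of [c] is given as a natural number [k] because it serves as an
    exponent of [A]. *)
Lemma GGS_regular_branch m (e : 'rV['Z_m]_m.-1) (c : 'Z_m) (k : nat) :
    (1 < m)%N -> (c * k%:R = 1)%R ->
    (forall i, e 0%R i = c \/ e 0%R i = 0%R) ->
    (exists i, e 0%R i = c) -> (exists i, e 0%R i = 0%R) ->
  regular_branch_over (GGS e) (lower_central 3 (GGS e)).
Proof.
case: m e c => [|[|q]] //= e c _ ck eP [i0 ei0] [i1 ei1].
pose x_ (i : 'I_q.+1) : 'I_q.+2 := widen_ord (leqnSn _) i.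
(* The letter of value [i] lies [i + 1] steps after the last letter. *)
pose Y (d : 'I_q.+2) := [exists i : 'I_q.+1, (val i == val (d - 1)%R) && (e 0%R i == c)].
have m1E : val (- 1 : 'I_q.+2)%R = q.+1.
  by rewrite /= !modn_small ?subn1.
have c0 : c != 0%R.
  by apply: contra_eq_neq ck => ->; rewrite mul0r eq_sym oner_eq0.
apply: (@regular_branch_over_gamma3 q (ggs_b e)
  (fun d => psi (ggs_b e) (d - 1)%R) c k Y) => //.
- rewrite -[LHS](diag_psi (@ggs_b_stab _ e)); apply: eq_diag => x.
  by rewrite addrK.
- apply/existsP => -[i /andP[/eqP]]; rewrite sub0r m1E => iE.
  by have := ltn_ord i; rewrite -[X in (X < _)%N]/(val i) iE ltnn.
- by rewrite sub0r psi_ggs_b m1E insubF // ltnn.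
- by move=> d /existsP[i /andP[/eqP dE /eqP ei]]; rewrite psi_ggs_b -dE valK ei.
- move=> d d0 /existsPn YNd; rewrite psi_ggs_b; case: insubP => [i _ iE|].
    by have := YNd i; rewrite iE eqxx /= => /eqP; have [->|->] := eP i.
  rewrite -leqNgt => dq; case/eqP: d0; apply/eqP; rewrite -subr_eq0 subr0.
  rewrite -[d](subrK 1%R) -[X in (X + _)%R]opprK addrC subr_eq0 eq_sym.
  rewrite eqr_oppLR.
  apply/eqP/val_inj; rewrite m1E; apply/eqP; rewrite eqn_leq dq andbT.
  by rewrite -ltnS ltn_ord.
- exists (x_ i0 + 1)%R; apply/existsP; exists i0.
  by rewrite addrK ei0 !eqxx.
- exists (x_ i1 + 1)%R.
    rewrite addr_eq0 -val_eqE m1E /=.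
    by rewrite neq_ltn ltn_ord.
  apply/existsPn => i; rewrite addrK; apply/negP => /andP[/eqP /val_inj -> /eqP].
  by rewrite ei1 => /esym/eqP; rewrite (negPf c0).
Qed.

Local Open Scope ring_scope.

Theorem theorem2p13 (p n : nat) (p_prime : prime p) (n_ge1 : (1 <= n)%N)
    (e : 'rV['Z_(p ^ n)]_(p ^ n).-1) (eF : calF p n e) :
  let Y := unit_support e in
  (forall i j, Y i -> Y j -> e 0 i = e 0 j) ->
  (forall i, ~ Y i -> e 0 i = 0) ->
  ~ (exists c, forall i, e 0 i = c) ->
  regular_branch_over (GGS e) (lower_central 3 (GGS e)).
Proof.
move=> Y eY eN ecst.
have m1 : (1 < p ^ n)%N by rewrite -(exp1n n) ltn_exp2r ?prime_gt1.
have [i0 Yi0] : exists i, Y i.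
  apply: contrapT => YN; case: eF => _; apply => i.
  have {}YN : e 0%R i = 0 %[mod p] by apply: contrapT => Yi; apply: YN; exists i.
  exists (e 0%R i %/ p)%N%:R => //.
  have pe : (p %| e 0%R i)%N by rewrite /dvdn YN mod0n.
  by rewrite -natrM mulnC divnK // natr_Zp.
have cU : e 0 i0 \is a GRing.unit.
  rewrite -(natr_Zp (e 0 i0)) unitZpE // coprimeXl // prime_coprime //.
  by apply/negP => /eqP pe; apply: Yi0; rewrite mod0n.
apply: (@GGS_regular_branch _ e (e 0 i0) (val (e 0 i0)^-1)) => //.
- by rewrite natr_Zp mulrV.
- move=> i; have [Yi|YNi] := pselect (Y i); first by left; apply: eY.
  by right; apply: eN.
- by exists i0.
apply: contrapT => e0; apply: ecst; exists (e 0 i0) => i; apply: eY => //.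
by apply: contrapT => /eN ei0; apply: e0; exists i.
Qed.
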